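(* Let $r/s>1$ be a rational number with regular continued fraction expansion $[a_1,\ldots,a_{2m}]$, let $n=a_1+\cdots+a_{2m}+2$, and let $\frac{\mathcal R(q)}{\mathcal S(q)}=\left[\frac rs\right]_q$. Then: (i) $\mathcal R(q)=1+\rho_1q+\rho_2q^2+\cdots+\rho_{n-4}q^{n-4}+q^{n-3}$, where for every $i$, $\rho_i$ is the number of $i$-vertex closures of the oriented graph $\mathcal G_{r/s}$; (ii) $\mathcal S(q)=1+\sigma_1q+\sigma_2q^2+\cdots+\sigma_{n-a_1-4}q^{n-a_1-4}+q^{n-a_1-3}$, where for every $i$, $\sigma_i$ is the number of $i$-vertex closures of the oriented graph $\mathcal G'_{r/s}$.
   Context: $q$ is a formal variable, $[a]_q=1+q+\cdots+q^{a-1}$, $[a]_{q^{-1}}=1+q^{-1}+\cdots+q^{-(a-1)}$. Every rational $r/s>1$ ($r,s$ coprime positive integers) has a unique expansion $r/s=[a_1,\ldots,a_{2m}]=a_1+\cfrac{1}{a_2+\cfrac{1}{\ddots+\cfrac{1}{a_{2m}}}}$ with an even number of integers $a_i\ge 1$. Its $q$-deformation is $$\left[\tfrac rs\right]_q=[a_1]_q+\cfrac{q^{a_1}}{[a_2]_{q^{-1}}+\cfrac{q^{-a_2}}{[a_3]_q+\cfrac{q^{a_3}}{\ddots\,[a_{2m-1}]_q+\cfrac{q^{a_{2m-1}}}{[a_{2m}]_{q^{-1}}}}}}$$ (odd-indexed terms $[a_i]_q$ followed by numerator $q^{a_i}$, even-indexed terms $[a_i]_{q^{-1}}$ followed by numerator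 $q^{-a_i}$), written as $\frac{\mathcal R}{\mathcal S}$ with $\mathcal R,\mathcal S\in\mathbb Z[q]$ coprime, $\mathcal R(1)=r$, $\mathcal S(1)=s$. The graph $\mathcal G_{r/s}$: take $n-3$ vertices $v_1,\ldots,v_{n-3}$ in a row and the $n-4$ edges $e_j=\{v_j,v_{j+1}\}$, $1\le j\le n-4$. Orient them, reading left to right, as follows: the first $a_1-1$ edges point left (from $v_{j+1}$ to $v_j$), the next $a_2$ edges point right (from $v_j$ to $v_{j+1}$), the next $a_3$ point left, the next $a_4$ point right, and so on alternately, the last $a_{2m}-1$ edges pointing right. The graph $\mathcal G'_{r/s}$ is obtained from $\mathcal G_{r/s}$ by deleting the first $a_1$ vertices $v_1,\ldots,v_{a_1}$ (and hence the first $a_1$ edges); it has $n-3-a_1$ vertices. A closure of an oriented graph is a set $\mathcal C$ of vertices such that no edge goes from a vertex of $\mathcal C$ to a vertex outside $\mathcal C$; an $i$-vertex closure is a closure with exactly $i$ elements (the empty set is the unique $0$-vertex closure). *)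

(* Defs.v *)
From HB Require Import structures.
From mathcomp Require Import all_boot all_order all_algebra.

Set Implicit Arguments.
Unset Strict Implicit.
Unset Printing Implicit Defensive.

Import Order.TTheory GRing.Theory Num.Theory.
Local Open Scope ring_scope.

Fixpoint cfrac (a : seq nat) : rat :=
  match a with
  | [::] => 0
  | [:: a1] => a1%:R
  | a1 :: a' => a1%:R + (cfrac a')^-1
  end.

Definition regular_cfrac (x : rat) (m : nat) (a : seq nat) : Prop :=
  [/\ size a = (2 * m)%N, {in a, forall k, (0 < k)%N} & cfrac a = x].

Definition qint (K : fieldType) (u : K) (k : nat) : K := \sum_(i < k) u ^+ i.

(* The parameter is inverted at each level, so that started at u = q the
   odd-indexed terms use q and the even-indexed ones use q^-1. *)
Fixpoint qcfrac_rec (K : fieldType) (u : K) (a : seq nat) : K :=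
  match a with
  | [::] => 0
  | [:: a1] => qint u a1
  | a1 :: a' => qint u a1 + u ^+ a1 / qcfrac_rec u^-1 a'
  end.

Definition qcfrac (a : seq nat) : {fraction {poly int}} :=
  qcfrac_rec (tofrac 'X) a.

(* Coprimality in Z[q] itself: coprimep would allow a common constant factor. *)
Definition coprimeZq (P Q : {poly int}) : Prop :=
  forall D A B : {poly int}, P = D * A -> Q = D * B -> D \is a GRing.unit.

Local Open Scope nat_scope.

(* Indices are shifted by one: ordinal i stands for v_(i+1), position j of
   edge_dirs for e_(j+1), and block i for a_(i+1). *)
Definition edge_count (a : seq nat) (i : nat) : nat :=
  nth 0 a i - (i == 0) - (i == (size a).-1).

(* true = pointing right, false = pointing left *)
Definition edge_dirs (a : seq nat) : seq bool :=
  flatten [seq nseq (edge_count a i) (odd i) | i <- iota 0 (size a)].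

(* With n = sumn a + 2, the vertices v_1, ..., v_(n-3). *)
Definition G_vertex (a : seq nat) : finType := 'I_(sumn a + 2 - 3).

Definition G_arc (a : seq nat) : rel (G_vertex a) := fun x y =>
  ((y == x.+1 :> nat) && nth false (edge_dirs a) x)
  || ((x == y.+1 :> nat) && ~~ nth false (edge_dirs a) y).

Definition G'_vertex (a : seq nat) : finType :=
  {x : G_vertex a | nth 0 a 0 <= x}.

Definition G'_arc (a : seq nat) : rel (G'_vertex a) :=
  fun x y => G_arc (val x) (val y).

Definition is_closure (T : finType) (e : rel T) (C : {set T}) : bool :=
  [forall x in C, forall y, e x y ==> (y \in C)].

Definition closure_count (T : finType) (e : rel T) (i : nat) : nat :=
  #|[set C : {set T} | is_closure e C & #|C| == i]|.

(* Main.v *)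
(* A continued fraction [a_1,...,a_2m] is read as the word L^a_1 R^a_2 ... R^a_2m.
   Each letter acts by a transfer matrix of determinant q on pairs (A, B), the
   generating functions of the closures avoiding, resp. containing, the leftmost
   vertex; the word has one edge too many at each end. Applied to (0, 1), the
   product gives (S', qR'), where R' and S' are the closure generating functions
   of G and G'. Two consecutive blocks act as two levels of the q-continued
   fraction, so that [r/s]_q = R'/S'. The determinant yields U S' + V R' = q^k,
   and S'(0) = 1 improves this to a Bezout relation U S' + V R' = 1. Hence
   R = D R' and S = D S' for some D, which coprimality forces to be a unit and
   positivity at q = 1 forces to be 1. *)

Require Import Defs.
From mathcomp Require Import all_boot all_order all_algebra.
From mathcomp Require Import zify ring.

Set Implicit Arguments.
Unset Strict Implicit.
Unset Printing Implicit Defensive.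

Import Order.TTheory GRing.Theory Num.Theory.
Local Open Scope ring_scope.

(** * Closure generating functions, and closures of a path as bit tuples *)

Lemma closure_count_gf (T : finType) (e : rel T) :
  \sum_(0 <= i < #|T|.+1) (closure_count e i)%:R *: 'X^i
    = \sum_(C : {set T} | is_closure e C) 'X^#|C| :> {poly int}.
Proof.
rewrite big_mkord (partition_big (fun C : {set T} => inord #|C| : 'I_#|T|.+1) xpredT) //=.
apply: eq_bigr => i _.
rewrite /closure_count cardsE scaler_nat -sumr_const.
apply: eq_big => [C|C]; last by case/andP=> _ /eqP->.
rewrite unfold_in; congr andb.
by rewrite -val_eqE /= inordK // ltnS max_card.
Qed.

Lemma closure_count0 (T : finType) (e : rel T) : closure_count e 0 = 1%N.
Proof.
rewrite /closure_count -(cards1 (@set0 T)); apply: eq_card => C.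
rewrite !inE cards_eq0 andbC; case: eqP => //= ->.
by apply/forall_inP => x; rewrite inE.
Qed.

Lemma closure_count_card (T : finType) (e : rel T) :
  closure_count e #|T| = 1%N.
Proof.
rewrite /closure_count -(cards1 [set: T]); apply: eq_card => C.
rewrite !inE andbC eqn_leq max_card -cardsT andTb.
rewrite [(_ <= _)%N](_ : _ = (C == setT)); last first.
  by rewrite eqEcard subsetT.
case: eqP => //= ->.
by apply/forall_inP => x _; apply/forallP => y; rewrite inE implybT.
Qed.

(** The bits [x] and [y] record whether the left and right ends of an edge lie in the closure. *)
Definition arrow_ok (c x y : bool) : bool := if c then x ==> y else y ==> x.

Fixpoint path_closed (d t : seq bool) : bool :=
  if t is x :: t' then
    (if t' is y :: _ then arrow_ok (head false d) x y else true)
      && path_closed (behead d) t'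
  else true.

Lemma path_closedP (d t : seq bool) :
  reflect (forall i, (i.+1 < size t)%N ->
             arrow_ok (nth false d i) (nth false t i) (nth false t i.+1))
          (path_closed d t).
Proof.
elim: t d => [|x t IH] d /=; first by left.
apply: (iffP andP) => [[hx ht] [|i] hi|H].
- by rewrite nth0; case: t hx hi {IH ht}.
- by rewrite -nth_behead; apply: (IH _ ht).
- split; first by case: t H {IH} => // y t /(_ 0%N isT); rewrite nth0.
  by apply/IH => i hi; rewrite nth_behead; apply: (H i.+1).
Qed.

(** The enumeration [f] is left general in order to serve both graphs: it is the identity for G and
    the shift by a_1 for G'. *)
Lemma path_closure_gf (T : finType) (e : rel T) (N : nat) (f : 'I_N -> T)
    (d : seq bool) :
  bijective f ->
  (forall x y : 'I_N, e (f x) (f y) =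
     ((y == x.+1 :> nat) && nth false d x)
     || ((x == y.+1 :> nat) && ~~ nth false d y)) ->
  \sum_(C : {set T} | is_closure e C) 'X^#|C|
    = \sum_(t : N.-tuple bool | path_closed d t) 'X^(count id t) :> {poly int}.
Proof.
move=> [g fK gK] eE.
pose h (t : N.-tuple bool) := [set x | tnth t (g x)].
rewrite (reindex h) /=; last first.
  exists (fun C : {set T} => [tuple f i \in C | i < N]) => [t _|C _].
    by apply: eq_from_tnth => i; rewrite tnth_mktuple inE fK.
  by apply/setP => x; rewrite inE tnth_mktuple gK.
apply: eq_big => [t|t _].
  apply/forall_inP/path_closedP => [H i|H x].
    rewrite size_tuple => hi; have hi' := ltnW hi.
    have hx := H (f (Ordinal hi')); have hy := H (f (Ordinal hi)).
    rewrite -[i in nth _ t i]/(val (Ordinal hi')).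
    rewrite -[i.+1]/(val (Ordinal hi)) -!tnth_nth.
    move: hx hy; rewrite !inE !fK /arrow_ok => hx hy.
    case: ifP => di; apply/implyP.
      move/hx/forallP/(_ (f (Ordinal hi))).
      by rewrite eE eqxx di inE fK.
    move/hy/forallP/(_ (f (Ordinal hi'))).
    by rewrite eE /= eqxx di orbT inE fK.
  rewrite inE => tx; apply/forallP => y; apply/implyP.
  rewrite -(gK x) -(gK y) eE inE gK.
  move: (g x) (g y) tx => i j; rewrite !(tnth_nth false) => ti.
  case/orP => /andP[/eqP hij di].
    have := H i; rewrite size_tuple -hij ltn_ord => /(_ isT).
    by rewrite /arrow_ok di ti.
  have := H j; rewrite size_tuple -hij ltn_ord => /(_ isT).
  by rewrite /arrow_ok (negPf di) ti.
congr ('X^ _).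
rewrite -sum1_card (reindex f) /=; last by exists g => x _.
rewrite -sum1_count big_tuple.
by apply: eq_bigl => i; rewrite inE fK.
Qed.

(** * Transfer matrices along a path *)

Definition transfer_step (c : bool) (v : {poly int} * {poly int}) :
    {poly int} * {poly int} :=
  if c then (v.1 + v.2, 'X * v.2) else (v.1, 'X * (v.1 + v.2)).

(* Starting from (0, 1) amounts to adding an extra last vertex, of weight 1, that
   is forced to belong to the closure: when the last edge points right (towards
   it) this imposes nothing on the other vertices. *)
Definition transfer (w : seq bool) : {poly int} * {poly int} :=
  foldr transfer_step (0, 1) w.

Lemma big_tuple_cons (N : nat) (P : pred (seq bool)) (F : seq bool -> {poly int}) :
  \sum_(t : N.+1.-tuple bool | P t) F t
    = \sum_(b : bool) \sum_(t : N.-tuple bool | P (b :: t)) F (b :: t).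
Proof.
rewrite pair_big_dep /=.
rewrite (reindex (fun p : bool * N.-tuple bool => [tuple of p.1 :: p.2])) //=.
exists (fun t : N.+1.-tuple bool => (thead t, [tuple of behead t])) => [[b t] _|t _].
  by congr pair; apply: val_inj.
by rewrite [RHS]tuple_eta.
Qed.

(** Induction on the word, conditioning on the bit of the second vertex. In the base case the last
    letter points right and the vector is (1, q), which describes a lone vertex. *)
Lemma transfer_path_gf (c : bool) (w : seq bool) (b : bool) :
  last c w ->
  \sum_(t : (size w).-tuple bool | path_closed (c :: w) (b :: t))
     'X^(count id (b :: t))
   = (if b then (transfer (c :: w)).2 else (transfer (c :: w)).1).
Proof.
elim: w c b => [|c' w IH] c b hl.
  move: hl => /= ->; rewrite (big_pred1 [tuple]) => [|t]; last by rewrite tuple0.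
  by case: b; rewrite /= ?addn0 ?expr1 ?expr0 ?mulr1 ?add0r.
rewrite (big_tuple_cons _ (fun s => path_closed (c :: c' :: w) (b :: s))
          (fun s => 'X^(count id (b :: s)))).
(* Once the first two bits are fixed, either their arrow is violated and the sum is empty, or the
   weight of the first vertex factors out. *)
have E b' : \sum_(t : (size w).-tuple bool | path_closed (c :: c' :: w) [:: b, b' & t])
     'X^(count id [:: b, b' & t]) = (if arrow_ok c b b' then 'X^b *
     (if b' then (transfer (c' :: w)).2 else (transfer (c' :: w)).1) else 0) :> {poly int}.
  rewrite -(IH c' b') //; case: ifP => hc; last first.
    by rewrite big_pred0 // => t /=; rewrite hc.
  rewrite mulr_sumr; apply: eq_big => t; first by rewrite /= hc.
  by rewrite -exprD.
rewrite big_bool /= !E /=.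
by case: c b {E hl} => [] [] //=; rewrite ?expr1 ?expr0 ?mul1r ?addr0 ?add0r //; ring.
Qed.

Lemma transfer_gf (w : seq bool) :
  last true w ->
  \sum_(t : (size w).-tuple bool | path_closed w t) 'X^(count id t)
    = (transfer w).1 + (transfer w).2.
Proof.
case: w => [|c w] hl.
  by rewrite (big_pred1 [tuple]) /= ?expr0 ?add0r // => t; rewrite tuple0.
rewrite (big_tuple_cons _ (path_closed (c :: w)) (fun s => 'X^(count id s))).
by rewrite big_bool !transfer_path_gf //= addrC.
Qed.

(** * The edge directions as an alternating word *)

Fixpoint alternating_word (c : bool) (a : seq nat) : seq bool :=
  if a is x :: a' then nseq x c ++ alternating_word (~~ c) a' else [::].

Lemma size_alternating_word (c : bool) (a : seq nat) :
  size (alternating_word c a) = sumn a.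
Proof. by elim: a c => //= x a IH c; rewrite size_cat size_nseq IH. Qed.

Lemma alternating_word_rcons (c : bool) (a : seq nat) (y : nat) :
  alternating_word c (rcons a y)
    = alternating_word c a ++ nseq y (c (+) odd (size a)).
Proof.
elim: a c => [|x a IH] c /=; first by rewrite addbF cats0.
by rewrite IH catA; congr (_ ++ nseq _ _); case: c; case: odd.
Qed.

Lemma flatten_alternating_word (f : nat -> nat) (k : nat) (a : seq nat) :
  (forall j, (j < size a)%N -> f (k + j)%N = nth 0%N a j) ->
  flatten [seq nseq (f i) (odd i) | i <- iota k (size a)]
    = alternating_word (odd k) a.
Proof.
elim: a k => //= x a IH k fE.
rewrite -(IH k.+1) => [|j hj]; last by rewrite addSnnS fE.
by rewrite -[k in f k]addn0 fE.
Qed.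

(** The two added letters restore the edges that [edge_count] removes from the end blocks.
    Positivity keeps these subtractions from truncating, length at least two keeps the end blocks
    distinct, and even length makes the last one point right. *)
Lemma edge_dirs_alternating_word (a : seq nat) :
  ~~ odd (size a) -> (1 < size a)%N -> {in a, forall k, (0 < k)%N} ->
  false :: rcons (edge_dirs a) true = alternating_word false a.
Proof.
case: a => // x a; case/lastP: a => // b y hodd _ pos.
have x_gt0 : (0 < x)%N by apply: pos; rewrite mem_head.
have y_gt0 : (0 < y)%N by apply: pos; rewrite inE mem_rcons mem_head orbT.
have sb : odd (size b) = false by move: hodd; rewrite /= size_rcons /= negbK; case: odd.
rewrite /edge_dirs /= size_rcons -(addn1 (size b)) iotaD map_cat flatten_cat.
rewrite flatten_alternating_word => [|j hj]; last first.
  by rewrite add1n /edge_count /= size_rcons nth_rcons hj; move: hj; lia.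
rewrite /= cats0 add1n alternating_word_rcons sb /=.
rewrite /edge_count /= size_rcons nth_rcons ltnn eqxx !subn0.
case: x x_gt0 {pos hodd} => // x _; case: y y_gt0 => // y _.
by rewrite eqxx !subn1 !rcons_cat -(cats1 (nseq _ _)) -(nseqD y 1) addn1.
Qed.

(** * Action of whole blocks, Bezout relation, values at 0 and 1 *)

Lemma transfer_nseq_false (k : nat) (w : seq bool) :
  transfer (nseq k false ++ w)
    = ((transfer w).1,
       'X * (\sum_(i < k) 'X^i) * (transfer w).1 + 'X^k * (transfer w).2).
Proof.
elim: k => [|k IH] /=; first by rewrite big_ord0 mulr0 mul0r expr0 mul1r add0r; case: transfer.
rewrite -/(transfer _) IH /= big_ord_recl expr0 exprS.
under [in RHS]eq_bigr => i _ do rewrite lift0 exprS.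
by rewrite -mulr_sumr; congr pair; ring.
Qed.

(** Either kind of block acts by a power of a triangular matrix; its off-diagonal entry is where the
    q-integers arise. *)
Lemma transfer_nseq_true (k : nat) (w : seq bool) :
  transfer (nseq k true ++ w)
    = ((transfer w).1 + (\sum_(i < k) 'X^i) * (transfer w).2,
       'X^k * (transfer w).2).
Proof.
elim: k => [|k IH] /=; first by rewrite big_ord0 mul0r expr0 mul1r addr0; case: transfer.
rewrite -/(transfer _) IH /= big_ord_recr exprS /=.
by congr pair; ring.
Qed.

(** A step matrix times its adjugate is q times the identity, so applying the adjugate to the row
    (U, V) extends the relation by one letter at the cost of a factor q. *)
Lemma transfer_bezout (w : seq bool) :
  exists U V, U * (transfer w).1 + V * (transfer w).2 = 'X^(size w).
Proof.
elim: w => [|c w [U [V UV]]]; first by exists 0, 1; rewrite /= expr0; ring.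
rewrite exprS -UV; case: c => /=; rewrite -/(transfer _).
  by exists ('X * U), (V - U); ring.
by exists ('X * (U - V)), V; ring.
Qed.

(** Writing P = 1 + W q makes -W an inverse of q modulo P. The exponent then drops one unit at a
    time through q^k = q^k P - W q^(k+1). *)
Lemma comaximal_of_bezoutX (P Q : {poly int}) (k : nat) :
  P.[0] = 1 -> (exists U V, U * P + V * Q = 'X^k) ->
  exists U V, U * P + V * Q = 1.
Proof.
move=> P0; have [W WE] : exists W, P = 1 + W * 'X.
  have : root (P - 1) 0 by rewrite rootE hornerD hornerN hornerC P0 subrr.
  by case/factor_theorem=> W WE; exists W; rewrite -[P](subrK 1) WE subr0 addrC.
elim: k => [|k IH] [U [V UV]]; first by exists U, V.
apply: IH; exists ('X^k - W * U), (- W * V).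
have -> : ('X^k - W * U) * P + - W * V * Q = 'X^k * P - W * (U * P + V * Q) by ring.
by rewrite UV WE exprS; ring.
Qed.

Lemma transfer_horner_ge0 (w : seq bool) (x : int) : 0 < x ->
  0 <= (transfer w).1.[x] /\ 0 < (transfer w).2.[x].
Proof.
move=> x0; elim: w => [|c w [IH1 IH2]]; first by rewrite /= horner0 hornerC.
case: c => /=; rewrite -/(transfer _) !hornerE /=; split => //.
- by rewrite addr_ge0 // ltW.
- by rewrite mulr_gt0.
- by rewrite mulr_gt0 // ltr_wpDl.
Qed.

(** Entries are consumed in pairs because two inversions bring the parameter back to q and two
    blocks bring the letter back to [false]. *)
Lemma size_pair_ind (T : Type) (P : seq T -> Prop) :
  P [::] -> (forall x y a, ~~ odd (size a) -> P a -> P [:: x, y & a]) ->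
  forall a, ~~ odd (size a) -> P a.
Proof.
move=> P0 PS a; have [n] := ubnP (size a); elim: n a => // n IH [|x [|y a]] //=.
rewrite negbK => ha h; apply: PS => //; apply: IH => //; lia.
Qed.

(** At q = 0 only the empty closure survives, and it avoids the leftmost vertex; the empty word
    keeps the initial vector (0, 1). *)
Lemma transfer_alternating_at0 (a : seq nat) :
  ~~ odd (size a) -> {in a, forall k, (0 < k)%N} ->
  (transfer (alternating_word false a)).1.[0] = (a != [::])%:R
  /\ (transfer (alternating_word false a)).2.[0] = (a == [::])%:R.
Proof.
move=> ha; elim/size_pair_ind: a / ha => [_|x y a _ IH pos].
  by rewrite /= horner0 hornerC.
have x_gt0 : (0 < x)%N by apply: pos; rewrite mem_head.
have y_gt0 : (0 < y)%N by apply: pos; rewrite !inE eqxx orbT.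
have [|IH1 IH2] := IH; first by move=> k hk; apply: pos; rewrite !inE hk !orbT.
rewrite /= transfer_nseq_false transfer_nseq_true /= !hornerE /=.
case: x x_gt0 {pos} => // x _; case: y y_gt0 => // y _.
rewrite !expr0n /= IH1 IH2 big_ord_recl !hornerE.
rewrite horner_sum big1 => [|i _]; last by rewrite !hornerE exprS mul0r.
by case: a {IH IH1 IH2}.
Qed.

(** * The q-continued fraction as a quotient of transfer components *)

Lemma qcfrac_rec_cons (K : fieldType) (u : K) (x : nat) (a : seq nat) :
  qcfrac_rec u (x :: a) = qint u x + u ^+ x / qcfrac_rec u^-1 a.
(* For a singleton the tail has value 0, and the convention 0^-1 = 0 removes its term. *)
Proof. by case: a => //=; rewrite invr0 mulr0 addr0. Qed.

Lemma qint_inv (K : fieldType) (u : K) (k : nat) :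
  u != 0 -> u ^+ k * qint u^-1 k = u * qint u k.
Proof.
move=> u0; rewrite /qint !mulr_sumr (reindex_inj rev_ord_inj) /=.
apply: eq_bigr => i _; rewrite -exprS exprVn.
have -> : u ^+ k = u ^+ i.+1 * u ^+ (k - i.+1) by rewrite -exprD subnKC.
by rewrite mulfK // expf_neq0.
Qed.

(** The tail has value B / (q A). At the end of the fraction A = 0, and then both this quotient and
    its inverse are 0, as an absent tail requires. *)
Lemma qcfrac_two_step (K : fieldType) (q A B : K) (x y : nat) :
  q != 0 -> B != 0 -> A + qint q y * B != 0 ->
  qint q x + q ^+ x / (qint q^-1 y + q^-1 ^+ y / (B / (q * A)))
    = (q * qint q x * (A + qint q y * B) + q ^+ x * (q ^+ y * B))
      / (q * (A + qint q y * B)).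
Proof.
move=> q0 B0 AB0; have qn k : q ^+ k != 0 by rewrite expf_neq0.
rewrite invf_div -(mulKf (qn y) (qint q^-1 y)) qint_inv // exprVn.
have -> : (q ^+ y)^-1 * (q * qint q y) + (q ^+ y)^-1 * (q * A / B)
          = q * (A + qint q y * B) / (q ^+ y * B).
  by field; rewrite B0 qn.
by rewrite invf_div; field; rewrite q0 AB0.
Qed.

Lemma qcfrac_rec_transfer (K : fieldType) (f : {rmorphism {poly int} -> K})
    (a : seq nat) :
  injective f -> ~~ odd (size a) -> {in a, forall k, (0 < k)%N} ->
  let v := transfer (alternating_word false a) in
  qcfrac_rec (f 'X) a = f v.2 / (f 'X * f v.1).
Proof.
move=> f_inj ha; elim/size_pair_ind: a / ha => [_|x y a ha IH pos] /=.
  by rewrite rmorph0 mulr0 invr0 mulr0.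
have pos' : {in a, forall k, (0 < k)%N}.
  by move=> k hk; apply: pos; rewrite !inE hk !orbT.
have f0 p : p != 0 -> f p != 0 by apply: contra_neq => fp; apply: f_inj; rewrite fp rmorph0.
have X0 : f 'X != 0 by rewrite f0 ?polyX_eq0.
(* The new denominator is nonzero since it is 1 at q = 0, and B is nonzero since it is positive at q
   = 1. *)
have A0 : f (transfer (alternating_word false [:: x, y & a])).1 != 0.
  apply/f0/eqP => A0.
  have [] := @transfer_alternating_at0 [:: x, y & a] _ pos; first by rewrite /= negbK.
  by rewrite A0 horner0.
have B0 : f (transfer (alternating_word false a)).2 != 0.
  apply/f0/eqP => B0.
  have [_] := @transfer_horner_ge0 (alternating_word false a) 1 isT.
  by rewrite B0 horner0.
have qE k : f (\sum_(i < k) 'X^i) = qint (f 'X) k.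
  by rewrite rmorph_sum; apply: eq_bigr => i _; rewrite rmorphXn.
move: A0; rewrite /= transfer_nseq_false transfer_nseq_true /=.
rewrite -/(qcfrac_rec _ (x :: y :: a)) 2!qcfrac_rec_cons invrK IH //.
rewrite !(rmorphD, rmorphM, rmorphXn) /= !qE => A0.
exact: qcfrac_two_step.
Qed.

Lemma qcfrac_transfer (a : seq nat) :
  ~~ odd (size a) -> {in a, forall k, (0 < k)%N} ->
  let v := transfer (alternating_word false a) in
  qcfrac a = tofrac v.2 / (tofrac 'X * tofrac v.1).
Proof.
move=> ha pos; apply: (qcfrac_rec_transfer _ ha pos).
by move=> p q /eqP; rewrite tofrac_eq => /eqP.
Qed.

(** * Uniqueness of the reduced fraction *)

Lemma tofrac_div_eq (A : idomainType) (x P Q R S : A) :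
  x != 0 -> Q != 0 -> S != 0 ->
  tofrac (x * P) / (tofrac x * tofrac Q) = tofrac R / tofrac S -> P * S = R * Q.
Proof.
move=> x0 Q0 S0 /eqP; rewrite tofracM -mulf_div divff ?tofrac_eq0 // mul1r.
by rewrite eqr_div ?tofrac_eq0 // -!tofracM tofrac_eq => /eqP.
Qed.

Lemma poly_int_unit_pos (D : {poly int}) :
  D \is a GRing.unit -> 0 < D.[1] -> D = 1.
Proof.
rewrite poly_unitE => /andP[/size_poly1P[c c0 ->]].
rewrite coefC eqxx hornerC => /orP[/eqP-> //|/eqP->] //.
Qed.

Lemma coprime_fraction_unique (P Q R S : {poly int}) :
  (exists U V, U * P + V * Q = 1) -> P * S = R * Q -> coprimeZq R S ->
  0 <= Q.[1] -> 0 < S.[1] -> P = R /\ Q = S.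
Proof.
(* By P S = R Q, this choice gives D P = R (U P + V Q) = R, and likewise D Q = S. *)
move=> [U [V UV]] PS RS Q1 S1; pose D := U * R + V * S.
have RE : R = D * P.
  rewrite -[LHS]mulr1 -UV mulrDr [in X in _ + X]mulrCA -PS /D; ring.
have SE : S = D * Q.
  rewrite -[LHS]mulr1 -UV mulrDr [in X in X + _]mulrCA [S * P]mulrC PS /D; ring.
have D1 : D = 1.
  apply: poly_int_unit_pos; first exact: RS RE SE.
  move: S1; rewrite SE hornerM => S1; have Q1' : 0 < Q.[1].
    by rewrite lt_def Q1 andbT; apply: contraTneq S1 => ->; rewrite mulr0.
  by rewrite pmulr_lgt0 in S1.
by rewrite RE SE D1 !mul1r.
Qed.

(** * Application to G and G' *)

Lemma closure_count_transfer (T : finType) (e : rel T) (N : nat) (f : 'I_N -> T)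
    (w : seq bool) :
  bijective f -> N = size w -> last true w ->
  (forall x y : 'I_N, e (f x) (f y) =
     ((y == x.+1 :> nat) && nth false w x)
     || ((x == y.+1 :> nat) && ~~ nth false w y)) ->
  [/\ (transfer w).1 + (transfer w).2
        = \sum_(0 <= i < N.+1) (closure_count e i)%:R *: 'X^i,
      closure_count e 0 = 1%N & closure_count e N = 1%N].
Proof.
move=> f_bij; have cT : #|T| = N by rewrite -(bij_eq_card f_bij) card_ord.
move=> Nw lw eE; split; [|exact: closure_count0|].
- rewrite -{1}cT closure_count_gf (path_closure_gf f_bij eE).
  by rewrite -(transfer_gf lw) -Nw.
- by rewrite -cT closure_count_card.
Qed.

Theorem theorem3p5 (r s m : nat) (a : seq nat) (R S : {poly int})
    (s_gt0 : (0 < s)%N) (rs_coprime : coprime r s)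
    (rs_gt1 : 1 < r%:R / s%:R :> rat)
    (rs_cfrac : regular_cfrac (r%:R / s%:R) m a)
    (RS_qcfrac : qcfrac a = tofrac R / tofrac S)
    (RS_coprime : coprimeZq R S)
    (R_at1 : R.[1] = r%:R) (S_at1 : S.[1] = s%:R) :
  let n := (sumn a + 2)%N in
  let a1 := nth 0%N a 0 in
  let rho := closure_count (@G_arc a) in
  let sigma := closure_count (@G'_arc a) in
  [/\ R = \sum_(0 <= i < (n - 3).+1) (rho i)%:R *: 'X^i,
      rho 0%N = 1%N & rho (n - 3)%N = 1%N]
  /\
  [/\ S = \sum_(0 <= i < (n - a1 - 3).+1) (sigma i)%:R *: 'X^i,
      sigma 0%N = 1%N & sigma (n - a1 - 3)%N = 1%N].
Proof.
case: rs_cfrac => size_a pos cfrac_a n a1 rho sigma.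
have ev : ~~ odd (size a) by rewrite size_a oddM.
(* The length is even, and the empty list has value 0, which is not above 1. *)
have size_gt1 : (1 < size a)%N.
  case: a size_a ev cfrac_a {pos RS_qcfrac n a1 rho sigma} => [|? []] // _ _ cf.
  by move: rs_gt1; rewrite -cf.
have wE := edge_dirs_alternating_word ev size_gt1 pos.
pose w := rcons (edge_dirs a) true.
(* After the a_1 - 1 left arrows comes the right arrow leaving v_(a_1), deleted together with that
   vertex; [w'] is the word of G'. *)
have [w' [w'E wS w'l]] : exists w', [/\ drop a1 w = w', w = nseq a1.-1 false ++ true :: w' & last true w'].
  have lw : last true w by rewrite last_rcons.
  move: wE lw; rewrite -/w {}/a1; clearbody w.
  case: a size_gt1 pos {rho sigma n RS_qcfrac cfrac_a ev size_a} => [|x [|y a]] //= _ pos.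
  have x_gt0 : (0 < x)%N by apply: pos; rewrite mem_head.
  have y_gt0 : (0 < y)%N by apply: pos; rewrite !inE eqxx orbT.
  case: x x_gt0 {pos} => // x _; case: y y_gt0 => // y _ /= [->].
  rewrite last_cat /= => lw; exists (nseq y true ++ alternating_word false a).
  split => //.
  by rewrite -cat_rcons drop_size_cat // size_rcons size_nseq.
have a1_gt0 : (0 < a1)%N.
  by apply: pos; apply: mem_nth; apply: ltnW.
have size_w : size w = (n - 3)%N.
  have := congr1 size wE; rewrite size_alternating_word /= -/w /n; lia.
have size_w' : size w' = (n - a1 - 3)%N.
  by rewrite -w'E size_drop size_w -!subnDA addnC.
set v := transfer w'.
(* A closure avoiding v_1 avoids v_1, ..., v_(a_1), since these arrows point left. The arrow leaving
   v_(a_1) then constrains nothing, so what remains is an arbitrary closure of G'. *)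
have vE : transfer (false :: w) = (v.1 + v.2, 'X * ((transfer w).1 + (transfer w).2)).
  have <- : (transfer w).1 = v.1 + v.2 by rewrite wS transfer_nseq_false.
  by [].
have [RE SE] : (transfer w).1 + (transfer w).2 = R /\ v.1 + v.2 = S.
  have := qcfrac_transfer ev pos; rewrite -wE vE /= RS_qcfrac => frE.
  have S0 : S != 0.
    by apply: contraTneq s_gt0 => S0; move: S_at1; rewrite S0 horner0 => /esym/eqP;
       rewrite pnatr_eq0 => /eqP->.
  have Q0 : (v.1 + v.2).[0] = 1.
    have [] := transfer_alternating_at0 ev pos; rewrite -wE vE /= => -> _.
    by case: (a) size_gt1.
  apply: coprime_fraction_unique RS_coprime _ _.
  - have [U [V]] := transfer_bezout (false :: w); rewrite vE /= => UV.
    have [|V' [U' UV']] := comaximal_of_bezoutX Q0 (Q := (transfer w).1 + (transfer w).2) (k := (size w).+1).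
      (* The factor q of the second component is absorbed into the coefficient V. *)
      by exists U, (V * 'X); rewrite -mulrA.
    by exists U', V'; rewrite addrC.
  - have Q0' : v.1 + v.2 != 0.
      by apply: contra_eq_neq Q0 => ->; rewrite horner0.
    exact: (tofrac_div_eq (negbT (polyX_eq0 _)) Q0' S0 (esym frE)).
  - have [h1 h2] := @transfer_horner_ge0 w' 1 isT.
    by rewrite hornerD addr_ge0 // ltW.
  - by rewrite S_at1 ltr0n.
(* An actual edge has its right end [l] among the n - 3 vertices, so its index stays below that of
   the last letter added in [w]. *)
have dirsE (k l : nat) : l = k.+1 -> (l < n - 3)%N ->
    nth false (edge_dirs a) k = nth false w k.
  by move=> ->; rewrite -size_w size_rcons ltnS /w nth_rcons => ->.
rewrite -RE -SE; split.
  apply: (closure_count_transfer (f := id)) => //.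
  - by exists id.
  - by rewrite last_rcons.
  move=> x y; rewrite /G_arc /=.
  by congr orb; case: eqP => //= xy; rewrite (dirsE _ _ xy (ltn_ord _)).
have shift_lt (i : 'I_(n - a1 - 3)) : (a1 + i < n - 3)%N by have := ltn_ord i; lia.
pose f (i : 'I_(n - a1 - 3)) : G'_vertex a :=
  exist _ (Ordinal (shift_lt i) : G_vertex a) (leq_addr i a1).
have unshift_lt (x : G'_vertex a) : (val (val x) - a1 < n - a1 - 3)%N.
  have := valP x; have := ltn_ord (val x); rewrite /= -/a1 /n; lia.
apply: (closure_count_transfer (f := f)) => //.
- exists (fun x => Ordinal (unshift_lt x)) => [i|x].
    by apply: val_inj; rewrite /= addKn.
  by do 2!apply: val_inj; rewrite /= subnKC //; apply: (valP x).
- move=> x y; rewrite /G'_arc /G_arc /= -!(addnS a1) !eqn_add2l.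
  rewrite -w'E !nth_drop.
  congr orb; case: eqP => //= xy.
    by rewrite (dirsE _ (a1 + y)%N) ?shift_lt // xy addnS.
  by rewrite (dirsE _ (a1 + x)%N) ?shift_lt // xy addnS.
Qed.
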